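(* Let $(u_1,u_2,p_{u_1},p_{u_2})$ be canonical coordinates on $T^*\mathbb R^2$, with $\{u_i,p_{u_j}\}=\delta_{ij}$, $\{u_1,u_2\}=\{p_{u_1},p_{u_2}\}=0$. On the domain $u_1\neq u_2$, $u_1u_2\ne0$, the geodesic flow with Hamiltonian $$T=\frac{u_1(2u_1+u_2)p_{u_1}^2}{u_1-u_2}+\frac{u_2(u_1+2u_2)p_{u_2}^2}{u_2-u_1}$$ is superintegrable: with the polynomials of fourth and third order in the momenta $$K=\frac{u_1^2u_2^2(p_{u_1}-p_{u_2})^3\bigl((3u_1+u_2)p_{u_1}+(u_1+3u_2)p_{u_2}\bigr)}{(u_1-u_2)^3},\qquad J=\frac{u_1u_2(p_{u_1}-p_{u_2})^2(u_1^2p_{u_1}-u_2^2p_{u_2})}{(u_1-u_2)^3},$$ one has $$\{T,K\}=0,\qquad \{T,J\}=0,\qquad \{J,K\}\neq0.$$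
   Context: Here $\{J,K\}\neq0$ means that $\{J,K\}$ is not identically zero. Superintegrable means that, in two degrees of freedom, the Hamiltonian $T$ admits two additional integrals of motion that are functionally independent together with $T$. *)

(* Defs.v *)
From HB Require Import structures.
From mathcomp Require Import all_boot all_order all_algebra.
From mathcomp Require Import all_classical all_reals all_analysis.

Set Implicit Arguments.
Unset Strict Implicit.
Unset Printing Implicit Defensive.

Import Order.TTheory GRing.Theory Num.Theory.
Import numFieldNormedType.Exports.

Local Open Scope classical_set_scope.
Local Open Scope ring_scope.

(* A point of T^*R^n is z = (u, p): positions z.1, momenta z.2. *)
Notation phase R n := ('rV[R]_n * 'rV[R]_n)%type.

Definition pos_dir (R : realType) (n : nat) (i : 'I_n) : phase R n :=
  (delta_mx 0 i, 0).

Definition mom_dir (R : realType) (n : nat) (i : 'I_n) : phase R n :=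
  (0, delta_mx 0 i).

(* Sign convention: {u_i, p_j} = delta_ij. *)
Definition poisson (R : realType) (n : nat) (f g : phase R n -> R)
    (z : phase R n) : R :=
  \sum_(i < n) ('D_(pos_dir R i) f z * 'D_(mom_dir R i) g z
                - 'D_(mom_dir R i) f z * 'D_(pos_dir R i) g z).

(* C^k on D; only used for open D. *)
Fixpoint Ck (R : realType) (V : normedModType R) (k : nat) (D : set V)
    (f : V -> R) : Prop :=
  match k with
  | 0 => forall z, D z -> {for z, continuous f}
  | k'.+1 => (forall z, D z -> differentiable f z) /\
             (forall v, Ck k' D (fun z => 'D_v f z))
  end.

Definition smooth (R : realType) (V : normedModType R) (D : set V)
    (f : V -> R) : Prop := forall k, Ck k D f.

Definition lin_indep_differentials (R : realType) (V : normedModType R)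
    (k : nat) (F : k.-tuple (V -> R)) (z : V) : Prop :=
  forall a : 'I_k -> R,
    (forall v : V, \sum_(i < k) a i * 'd (tnth F i) z v = 0) ->
    forall i, a i = 0.

(* The differentials are linearly independent on a dense subset of D (which is
   relatively open as soon as the functions are C^1). *)
Definition functionally_independent (R : realType) (V : normedModType R)
    (k : nat) (D : set V) (F : k.-tuple (V -> R)) : Prop :=
  D `<=` closure (D `&` [set z | lin_indep_differentials F z]).

Definition first_integral (R : realType) (n : nat) (D : set (phase R n))
    (H F : phase R n -> R) : Prop :=
  smooth D F /\ (forall z, D z -> poisson H F z = 0).

Definition superintegrable (R : realType) (D : set (phase R 2))
    (H : phase R 2 -> R) : Prop :=
  smooth D H /\
  exists F G : phase R 2 -> R,
    [/\ first_integral D H F, first_integral D H G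
      & functionally_independent D [tuple H; F; G]].

(* On D, f is a polynomial of degree d in the momenta, with coefficients
   depending on the positions, and its part of degree d is not identically 0. *)
Definition momentum_degree (R : realType) (D : set (phase R 2)) (d : nat)
    (f : phase R 2 -> R) : Prop :=
  exists c : nat -> nat -> 'rV[R]_2 -> R,
    (forall z, D z ->
       f z = \sum_(i < d.+1) \sum_(j < d.+1 | (i + j <= d)%N)
               c i j z.1 * z.2 0 0 ^+ i * z.2 0 1 ^+ j) /\
    (exists z (i : nat), [/\ D z, (i <= d)%N & c i (d - i)%N z.1 != 0]).

Definition dom (R : realType) : set (phase R 2) :=
  [set z : phase R 2 | let u1 := z.1 0 0 in let u2 := z.1 0 1 in
           u1 != u2 /\ u1 * u2 != 0].

Definition T (R : realType) (z : phase R 2) : R :=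
  let u1 := z.1 0 0 in let u2 := z.1 0 1 in
  let p1 := z.2 0 0 in let p2 := z.2 0 1 in
  u1 * (2 * u1 + u2) * p1 ^+ 2 / (u1 - u2)
  + u2 * (u1 + 2 * u2) * p2 ^+ 2 / (u2 - u1).

Definition K (R : realType) (z : phase R 2) : R :=
  let u1 := z.1 0 0 in let u2 := z.1 0 1 in
  let p1 := z.2 0 0 in let p2 := z.2 0 1 in
  u1 ^+ 2 * u2 ^+ 2 * (p1 - p2) ^+ 3
    * ((3 * u1 + u2) * p1 + (u1 + 3 * u2) * p2)
  / (u1 - u2) ^+ 3.

Definition J (R : realType) (z : phase R 2) : R :=
  let u1 := z.1 0 0 in let u2 := z.1 0 1 in
  let p1 := z.2 0 0 in let p2 := z.2 0 1 in
  u1 * u2 * (p1 - p2) ^+ 2 * (u1 ^+ 2 * p1 - u2 ^+ 2 * p2)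
  / (u1 - u2) ^+ 3.

(* Main.v *)
Require Import Defs.
From mathcomp Require Import all_boot all_order all_algebra.
From mathcomp Require Import all_classical all_reals all_analysis.
From mathcomp Require Import ring.
Import Order.TTheory GRing.Theory Num.Theory.
Import numFieldNormedType.Exports.

Set Implicit Arguments.
Unset Strict Implicit.
Unset Printing Implicit Defensive.

Local Open Scope classical_set_scope.
Local Open Scope ring_scope.

(* The brackets {T,K} and {T,J} are rational identities, and {J,K} = 4 J^2, so
   {J,K} vanishes exactly where J does.  If a dT + b dJ + c dK = 0 at a point
   where {J,K} != 0, pairing with the Hamiltonian vector fields of K and J gives
   b = c = 0, and a = 0 as soon as dT/dp1 != 0.  The two nonvanishing conditions
   amount to G != 0 for a nonzero polynomial G, hence hold on a dense set. *)

(** * Closure properties of the classes [Ck] *)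

(** The first-order expansion of [f] at [z] is also one for [g], so by uniqueness ['d f z] is the
    differential of [g]. *)
Lemma differentiable_near_eq (R : realType) (V W : normedModType R) (f g : V -> W) (z : V) :
  (\near z, f z = g z) -> differentiable f z -> differentiable g z.
Proof.
move=> fg /diff_locallyP[fc fo].
have gz : g z = f z by rewrite (nbhs_singleton fg).
have go : g \o shift z = cst (g z) + 'd f z +o_ 0 id.
  apply/eqaddoP => e e0; move/eqaddoP: fo => /(_ e e0) fo.
  have fg0 : \forall h \near 0, f (h + z) = g (h + z).
    by rewrite (near_shift 0 z) in fg; move: fg; apply: filterS => h /=; rewrite subr0.
  near=> h.
  have : f (h + z) = g (h + z) by near: h.
  have : `|(f \o shift z - (cst (f z) + 'd f z)) h| <= e * `|h| by near: h.
  rewrite !fctE /= gz => + <-; by [].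
have dg : 'd g z = 'd f z :> (V -> W) by apply: diff_unique.
by apply/diff_locallyP; rewrite dg.
Unshelve. all: by end_near. Qed.

Section Ck.
Variables (R : realType) (V : normedModType R) (D : set V).
Hypothesis oD : open D.

(** Since [D] is open, equality on [D] is equality near each of its points, so it passes to
    directional derivatives. The rules below rely on this: their derivative formulas are only known
    on [D]. *)
Lemma Ck_eq k (f g : V -> R) : {in D, f =1 g} -> Ck k D f -> Ck k D g.
Proof.
have near_eq (f' g' : V -> R) z : {in D, f' =1 g'} -> D z -> \near z, f' z = g' z.
  move=> fg Dz; move: (open_nbhs_nbhs (conj oD Dz)); apply: filterS => y Dy.
  by apply: fg; rewrite inE.
elim: k f g => [|k IH] f g fg /=.
  move=> cf z Dz; have fz := near_eq _ _ _ fg Dz.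
  rewrite /continuous_at /prop_for -(nbhs_singleton fz).
  exact: cvg_trans (near_eq_cvg fz) (cf z Dz).
move=> [df Dvf]; split=> [z Dz|v].
  by apply: differentiable_near_eq (df z Dz); apply: near_eq.
apply: IH (Dvf v) => z; rewrite inE => Dz.
by apply: near_eq_derive; apply: near_eq.
Qed.

(** The derivative of a product pairs each undifferentiated factor with a derivative of the other,
    so induction on [k] needs the factors themselves one order lower. *)
Lemma Ck_le k (f : V -> R) : Ck k.+1 D f -> Ck k D f.
Proof.
elim: k f => [|k IH] f [df Dvf]; first by move=> z /df/differentiable_continuous.
by split=> // v; apply: IH.
Qed.

Lemma Ck_cst k (c : R) : Ck k D (fun=> c).
Proof.
elim: k c => [|k IH] c; first by move=> z _; apply: cvg_cst.
split=> [z _|v]; first exact: differentiable_cst.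
by apply: Ck_eq (IH 0) => z _; rewrite derive_cst.
Qed.

Lemma CkD k (f g : V -> R) :
  Ck k D f -> Ck k D g -> Ck k D (fun z => f z + g z).
Proof.
elim: k f g => [|k IH] f g; first by move=> cf cg z Dz; apply: cvgD; [apply: cf|apply: cg].
move=> [df Df] [dg Dg]; split=> [z Dz|v].
  by apply: differentiableD; [apply: df|apply: dg].
apply: Ck_eq (IH _ _ (Df v) (Dg v)) => z; rewrite inE => Dz.
by rewrite deriveD//; apply: diff_derivable; [apply: df|apply: dg].
Qed.

Lemma CkM k (f g : V -> R) :
  Ck k D f -> Ck k D g -> Ck k D (fun z => f z * g z).
Proof.
elim: k f g => [|k IH] f g; first by move=> cf cg z Dz; apply: cvgM; [apply: cf|apply: cg].
move=> Cf Cg; have [[df Df] [dg Dg]] := (Cf, Cg); split=> [z Dz|v].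
  by apply: differentiableM; [apply: df|apply: dg].
have := CkD (IH _ _ (Ck_le Cf) (Dg v)) (IH _ _ (Ck_le Cg) (Df v)).
apply: Ck_eq => z; rewrite inE => Dz.
by rewrite deriveM//; apply: diff_derivable; [apply: df|apply: dg].
Qed.

Lemma CkV k (f : V -> R) :
  (forall z, D z -> f z != 0) -> Ck k D f -> Ck k D (fun z => (f z)^-1).
Proof.
move=> f0; elim: k => [|k IH].
  by move=> cf z Dz; apply: cvgV; [apply: f0|apply: cf].
move=> Cf; have [df Df] := Cf; split=> [z Dz|v].
  by apply: differentiableV; [apply: df|apply: f0].
(* The derivative [- f^-2 * 'D_v f] involves only [f^-1] and a derivative of [f], both already of
   class [Ck k]. *)
have Cif := IH (Ck_le Cf).
have := CkM (CkM (Ck_cst k (-1)) (CkM Cif Cif)) (Df v).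
apply: Ck_eq => z; rewrite inE => Dz.
rewrite deriveV ?f0//; last exact/diff_derivable/df.
by rewrite -exprVn expr2 mulN1r.
Qed.

Lemma CkX k n (f : V -> R) : Ck k D f -> Ck k D (fun z => f z ^+ n).
Proof.
move=> Cf; elim: n => [|n IH]; first exact: Ck_cst.
by apply: Ck_eq (CkM Cf IH) => z _; rewrite exprS.
Qed.

Lemma CkN k (f : V -> R) : Ck k D f -> Ck k D (fun z => - f z).
Proof.
by move=> Cf; apply: Ck_eq (CkM (Ck_cst k (-1)) Cf) => z _; rewrite mulN1r.
Qed.

End Ck.

(* Applied to coordinate functions, whose linear structure is not declared. *)
Lemma is_derive_lin (R : realType) (V : normedModType R) (f : V -> R) (z v : V) :
  (forall h, f (h *: v + z) = h * f v + f z) -> is_derive z v f (f v).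
Proof.
move=> fl; have cv : h^-1 *: ((f \o shift z) (h *: v) - f z) @[h --> 0^'] --> f v.
  (* For [h != 0] the difference quotient is exactly [f v]. *)
  apply: cvg_near_cst; near=> h.
  have h0 : h != 0 by near: h; exact: nbhs_dnbhs_neq.
  by rewrite /= fl addrK /GRing.scale /= mulKf.
split; first by apply/cvg_ex; exists (f v).
exact: cvg_lim cv.
Unshelve. all: by end_near. Qed.

(** Each directional derivative is the constant [f v], so all orders beyond the first reduce to
    [Ck_cst]. *)
Lemma Ck_lin (R : realType) (V : normedModType R) (D : set V) k (f : V -> R) :
  open D -> (forall z, differentiable f z) ->
  (forall h v z, f (h *: v + z) = h * f v + f z) -> Ck k D f.
Proof.
move=> oD df fl; case: k => [|k]; first by move=> z _; apply: differentiable_continuous.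
split=> // v; apply: Ck_eq (Ck_cst oD k (f v)) => // z _.
by have /@derive_val -> := is_derive_lin (fun h => fl h v z).
Qed.

(** * Coordinate functions, the domain, and density of nonvanishing sets *)

Lemma differentiable_pos (R : realType) n (i : 'I_n) (z : phase R n) :
  differentiable (fun z : phase R n => z.1 0 i : R) z.
Proof.
apply: (@differentiable_comp _ _ _ _ fst (fun x : 'rV[R]_n => x 0 i)).
  by apply: linear_differentiable => ?; exact: cvg_fst.
exact: differentiable_coord.
Qed.

Lemma differentiable_mom (R : realType) n (i : 'I_n) (z : phase R n) :
  differentiable (fun z : phase R n => z.2 0 i : R) z.
Proof.
apply: (@differentiable_comp _ _ _ _ snd (fun x : 'rV[R]_n => x 0 i)).
  by apply: linear_differentiable => ?; exact: cvg_snd.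
exact: differentiable_coord.
Qed.

Lemma open_dom (R : realType) : open (@dom R).
Proof.
have c1 i : continuous (fun z : phase R 2 => z.1 0 i).
  by move=> z; apply/differentiable_continuous/differentiable_pos.
(* Both conditions are merged into the nonvanishing of one continuous function. *)
have -> : @dom R = (fun z : phase R 2 => (z.1 0 0 - z.1 0 1) * (z.1 0 0 * z.1 0 1)) @^-1` [set x | x != 0].
  apply/seteqP; split=> z; rewrite /dom /= -(subr_eq0 (z.1 0 0)) (mulf_eq0 (_ - _)) negb_or; first by move=> [-> ->].
  by move=> /andP[].
apply: open_comp; last exact: open_neq.
by move=> z _; apply: cvgM; [apply: cvgB|apply: cvgM]; exact: c1.
Qed.

(* Along the line through [z] and [z0], [G] is a polynomial that is not
   identically 0, so its zeros do not accumulate at [z]. *)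
Lemma dense_neq0 (R : realType) (V : normedModType R) (G : V -> R) (z0 z : V) (D : set V) :
  open D -> D z -> G z0 != 0 ->
  (forall w v, exists p : {poly R}, forall t, G (t *: v + w) = p.[t]) ->
  closure (D `&` [set y | G y != 0]) z.
Proof.
move=> oD Dz G0 Gp B Bz.
have [p pE] := Gp z (z0 - z).
have p0 : p != 0.
  (* The parameter [t = 1] gives the point [z0], so [p.[1] = G z0] is nonzero. *)
  by apply: contraNneq G0 => p0; rewrite -[z0](subrK z) -[z0 - z]scale1r pE p0 horner0.
(* Splitting off the full power of ['X] leaves [q] with [q.[0] != 0]; hence [p] has no zero in a
   punctured neighbourhood of 0. *)
have [m [q /(implyP)/(_ p0) q0 pq]] := multiplicity_XsubC p 0.
have cl : (t *: (z0 - z) + z) @[t --> (0 : R)^'] --> z.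
  have : (t *: (z0 - z) + z) @[t --> (0 : R)] --> 0 *: (z0 - z) + z.
    by apply: cvgD; [apply: cvgZr_tmp; exact: cvg_id|exact: cvg_cst].
  rewrite scale0r add0r; apply: cvg_trans; apply: cvg_app; exact: nbhs_dnbhs.
have nq : \forall t \near (0 : R), q.[t] != 0.
  by have := @continuous_horner _ q 0 => /cvgr_neq0; apply.
near (0 : R)^' => t.
have t0 : t != 0 by near: t; exact: nbhs_dnbhs_neq.
have qt : q.[t] != 0 by near: t; exact: nbhs_dnbhs.
exists (t *: (z0 - z) + z); split; last by near: t; exact: cl.
split; first by near: t; apply: cl; exact: open_nbhs_nbhs.
by rewrite /= pE pq !hornerE mulf_neq0 // subr0 expf_neq0.
Unshelve. all: by end_near. Qed.

(* The library rules are stated for [f + g], [f * g], ..., whose syntax the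
   tactic below cannot match against a function given by its values. *)
Section PointwiseDeriveRules.
Variables (R : realType) (V : normedModType R) (f g : V -> R) (z v : V) (df dg : R).
Hypotheses (hf : is_derive z v f df) (hg : is_derive z v g dg).

Lemma is_deriveD_pt : is_derive z v (fun z => f z + g z) (df + dg).
Proof. exact: is_deriveD. Qed.

Lemma is_deriveN_pt : is_derive z v (fun z => - f z) (- df).
Proof. exact: is_deriveN. Qed.

Lemma is_deriveM_pt : is_derive z v (fun z => f z * g z) (f z * dg + g z * df).
Proof. exact: is_deriveM. Qed.

Lemma is_deriveX_pt n : is_derive z v (fun z => f z ^+ n) (n%:R * f z ^+ n.-1 * df).
Proof.
have -> : (fun z => f z ^+ n) = f ^+ n by apply/funext => y; rewrite fctE.
exact: is_deriveX.
Qed.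

Lemma is_deriveV_pt : f z != 0 -> is_derive z v (fun z => (f z)^-1) (- f z ^- 2 * df).
Proof.
move=> f0; have [fd fE] := hf; split; last by rewrite deriveV // fE.
exact: derivableV.
Qed.

End PointwiseDeriveRules.

(** * Directional derivatives of rational functions of the coordinates *)

Lemma is_derive_pos (R : realType) n (i : 'I_n) (z v : phase R n) :
  is_derive z v (fun z : phase R n => z.1 0 i : R) (v.1 0 i).
Proof. by apply: (is_derive_lin (f := fun z : phase R n => z.1 0 i)) => h; rewrite !mxE. Qed.

Lemma is_derive_mom (R : realType) n (i : 'I_n) (z v : phase R n) :
  is_derive z v (fun z : phase R n => z.2 0 i : R) (v.2 0 i).
Proof. by apply: (is_derive_lin (f := fun z : phase R n => z.2 0 i)) => h; rewrite !mxE. Qed.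

(** Separates the raw value [df], left as an existential variable for the rules to fill in, from the
    closed form [e], which [field] then checks. *)
Lemma derive_valE (R : realType) (V : normedModType R) (f : V -> R) (z v : V) (df e : R) :
  is_derive z v f df -> df = e -> 'D_v f z = e.
Proof. by move=> [_ ->]. Qed.

(** Recursion on the syntax of the function; the goals left over are the nonvanishing of
    denominators. *)
Ltac prove_is_derive :=
  lazymatch goal with
  | |- is_derive _ _ (fun z => @?f z + @?g z) _ => apply: (@is_deriveD_pt _ _ f g); prove_is_derive
  | |- is_derive _ _ (fun z => - @?f z) _ => apply: (@is_deriveN_pt _ _ f); prove_is_derive
  | |- is_derive _ _ (fun z => (@?f z)^-1) _ => apply: (@is_deriveV_pt _ _ f); [prove_is_derive|]
  | |- is_derive _ _ (fun z => @?f z ^+ _) _ => apply: (@is_deriveX_pt _ _ f); prove_is_derive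
  | |- is_derive _ _ (fun z => @?f z * @?g z) _ => apply: (@is_deriveM_pt _ _ f g); prove_is_derive
  | |- _ => first [exact: is_derive_cst | exact: is_derive_pos | exact: is_derive_mom]
  end.

(** * Differentials of [T], [K], [J] and their brackets *)

(** Over a common denominator [T] is [N / d], and the terms in [N / d ^+ 2] come from
    differentiating [d]. Keeping [v] general gives all four partial derivatives at once, as the
    coefficients that [poisson2E] expects. The same pattern serves [K] and [J], both of the form
    [N / d ^+ 3]. *)
Lemma derive_T (R : realType) (z v : phase R 2) : dom z ->
  let u1 := z.1 0 0 in let u2 := z.1 0 1 in
  let p1 := z.2 0 0 in let p2 := z.2 0 1 in
  let d := u1 - u2 in
  let N := u1 * (2 * u1 + u2) * p1 ^+ 2 - u2 * (u1 + 2 * u2) * p2 ^+ 2 in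
  'D_v (@T R) z =
    (((4 * u1 + u2) * p1 ^+ 2 - u2 * p2 ^+ 2) / d - N / d ^+ 2) * v.1 0 0
    + ((u1 * p1 ^+ 2 - (u1 + 4 * u2) * p2 ^+ 2) / d + N / d ^+ 2) * v.1 0 1
    + 2 * u1 * (2 * u1 + u2) * p1 / d * v.2 0 0
    + - 2 * u2 * (u1 + 2 * u2) * p2 / d * v.2 0 1.
Proof.
move=> [u12 _] /=.
have d0 : z.1 0 0 - z.1 0 1 != 0 by rewrite subr_eq0.
have d0' : z.1 0 1 - z.1 0 0 != 0 by rewrite subr_eq0 eq_sym.
rewrite /T; cbv zeta; eapply derive_valE; [prove_is_derive => // | simpl; field; exact/andP].
Qed.

Lemma derive_K (R : realType) (z v : phase R 2) : dom z ->
  let u1 := z.1 0 0 in let u2 := z.1 0 1 in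
  let p1 := z.2 0 0 in let p2 := z.2 0 1 in
  let d := u1 - u2 in let s := p1 - p2 in
  let l := (3 * u1 + u2) * p1 + (u1 + 3 * u2) * p2 in
  let N := u1 ^+ 2 * u2 ^+ 2 * s ^+ 3 * l in
  'D_v (@K R) z =
    (u1 * u2 ^+ 2 * s ^+ 3 * (2 * l + u1 * (3 * p1 + p2)) / d ^+ 3
      - 3 * N / d ^+ 4) * v.1 0 0
    + (u1 ^+ 2 * u2 * s ^+ 3 * (2 * l + u2 * (p1 + 3 * p2)) / d ^+ 3
      + 3 * N / d ^+ 4) * v.1 0 1
    + u1 ^+ 2 * u2 ^+ 2 * s ^+ 2 * (3 * l + s * (3 * u1 + u2)) / d ^+ 3 * v.2 0 0
    + u1 ^+ 2 * u2 ^+ 2 * s ^+ 2 * (- 3 * l + s * (u1 + 3 * u2)) / d ^+ 3 * v.2 0 1.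
Proof.
move=> [u12 _] /=.
have d0 : z.1 0 0 - z.1 0 1 != 0 by rewrite subr_eq0.
rewrite /K; cbv zeta; eapply derive_valE; [prove_is_derive; exact: expf_neq0 | simpl; field; exact: d0].
Qed.

Lemma derive_J (R : realType) (z v : phase R 2) : dom z ->
  let u1 := z.1 0 0 in let u2 := z.1 0 1 in
  let p1 := z.2 0 0 in let p2 := z.2 0 1 in
  let d := u1 - u2 in let s := p1 - p2 in
  let l := u1 ^+ 2 * p1 - u2 ^+ 2 * p2 in
  let N := u1 * u2 * s ^+ 2 * l in
  'D_v (@J R) z =
    (u2 * s ^+ 2 * (l + 2 * u1 ^+ 2 * p1) / d ^+ 3 - 3 * N / d ^+ 4) * v.1 0 0
    + (u1 * s ^+ 2 * (l - 2 * u2 ^+ 2 * p2) / d ^+ 3 + 3 * N / d ^+ 4) * v.1 0 1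
    + u1 * u2 * s * (2 * l + s * u1 ^+ 2) / d ^+ 3 * v.2 0 0
    + u1 * u2 * s * (- 2 * l - s * u2 ^+ 2) / d ^+ 3 * v.2 0 1.
Proof.
move=> [u12 _] /=.
have d0 : z.1 0 0 - z.1 0 1 != 0 by rewrite subr_eq0.
rewrite /J; cbv zeta; eapply derive_valE; [prove_is_derive; exact: expf_neq0 | simpl; field; exact: d0].
Qed.

(** Evaluating both linear forms on [pos_dir] and [mom_dir] picks out their coefficients, which
    turns a bracket into an algebraic expression within reach of [field]. *)
Lemma poisson2E (R : realType) (f g : phase R 2 -> R) (z : phase R 2)
    (a1 a2 a3 a4 b1 b2 b3 b4 : R) :
  (forall v, 'D_v f z = a1 * v.1 0 0 + a2 * v.1 0 1 + a3 * v.2 0 0 + a4 * v.2 0 1) ->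
  (forall v, 'D_v g z = b1 * v.1 0 0 + b2 * v.1 0 1 + b3 * v.2 0 0 + b4 * v.2 0 1) ->
  poisson f g z = a1 * b3 - a3 * b1 + (a2 * b4 - a4 * b2).
Proof.
move=> fE gE; rewrite /poisson !big_ord_recl big_ord0 !fE !gE /= !mxE /=; ring.
Qed.

Lemma poisson_TK (R : realType) (z : phase R 2) : dom z -> poisson (@T R) (@K R) z = 0.
Proof.
move=> dz; have d0 : z.1 0 0 - z.1 0 1 != 0 by move: dz => [+ _]; rewrite subr_eq0.
rewrite (poisson2E (fun v => derive_T v dz) (fun v => derive_K v dz)) /=; by field.
Qed.

Lemma poisson_TJ (R : realType) (z : phase R 2) : dom z -> poisson (@T R) (@J R) z = 0.
Proof.
move=> dz; have d0 : z.1 0 0 - z.1 0 1 != 0 by move: dz => [+ _]; rewrite subr_eq0.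
rewrite (poisson2E (fun v => derive_T v dz) (fun v => derive_J v dz)) /=; by field.
Qed.

Lemma poisson_JK (R : realType) (z : phase R 2) :
  dom z -> poisson (@J R) (@K R) z = 4 * J z ^+ 2.
Proof.
move=> dz; have d0 : z.1 0 0 - z.1 0 1 != 0 by move: dz => [+ _]; rewrite subr_eq0.
rewrite (poisson2E (fun v => derive_J v dz) (fun v => derive_K v dz)) /J /=; by field.
Qed.

(** * Smoothness on the domain *)

Lemma Ck_pos (R : realType) n (D : set (phase R n)) k (i : 'I_n) :
  open D -> Ck k D (fun z => z.1 0 i).
Proof.
move=> oD; apply: Ck_lin => //; first exact: differentiable_pos.
by move=> h v z; rewrite !mxE.
Qed.

Lemma Ck_mom (R : realType) n (D : set (phase R n)) k (i : 'I_n) :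
  open D -> Ck k D (fun z => z.2 0 i).
Proof.
move=> oD; apply: Ck_lin => //; first exact: differentiable_mom.
by move=> h v z; rewrite !mxE.
Qed.

Ltac prove_Ck oD :=
  lazymatch goal with
  | |- Ck _ _ (fun z => @?f z + @?g z) => apply: (CkD oD (f := f) (g := g)); prove_Ck oD
  | |- Ck _ _ (fun z => - @?f z) => apply: (CkN oD (f := f)); prove_Ck oD
  | |- Ck _ _ (fun z => (@?f z)^-1) => apply: (CkV oD (f := f)); [|prove_Ck oD]
  | |- Ck _ _ (fun z => @?f z ^+ _) => apply: (CkX oD _ (f := f)); prove_Ck oD
  | |- Ck _ _ (fun z => @?f z * @?g z) => apply: (CkM oD (f := f) (g := g)); prove_Ck oD
  | |- _ => first [exact: Ck_cst | exact: Ck_pos | exact: Ck_mom]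
  end.

Lemma smooth_T (R : realType) : smooth (@dom R) (@T R).
Proof.
move=> k; have oD := @open_dom R; rewrite /T; cbv zeta.
prove_Ck oD => z [z12 _]; first by rewrite subr_eq0.
by rewrite subr_eq0 eq_sym.
Qed.

Lemma smooth_K (R : realType) : smooth (@dom R) (@K R).
Proof.
move=> k; have oD := @open_dom R; rewrite /K; cbv zeta.
by prove_Ck oD => z [z12 _]; rewrite expf_neq0 // subr_eq0.
Qed.

Lemma smooth_J (R : realType) : smooth (@dom R) (@J R).
Proof.
move=> k; have oD := @open_dom R; rewrite /J; cbv zeta.
by prove_Ck oD => z [z12 _]; rewrite expf_neq0 // subr_eq0.
Qed.

(** * Functional independence *)

Lemma smooth_differentiable (R : realType) (V : normedModType R) (D : set V) (f : V -> R) z :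
  smooth D f -> D z -> differentiable f z.
Proof. by move=> /(_ 1)[+ _]; apply. Qed.

(* Bracketing a relation x A + y B + t C = 0 with C and with B leaves
   y {B,C} = 0 and t {C,B} = 0. *)
Lemma bracket_lin_indep (R : idomainType) (W : Type) n (e d : 'I_n -> W)
    (A B C : W -> R) (x y t : R) (v : W) :
  let br (f g : W -> R) := \sum_(i < n) (f (e i) * g (d i) - f (d i) * g (e i)) in
  br A B = 0 -> br A C = 0 -> br B C != 0 -> A v != 0 ->
  (forall w, x * A w + y * B w + t * C w = 0) -> [/\ x = 0, y = 0 & t = 0].
Proof.
move=> br AB AC BC Av rel.
have brx g : x * br A g + y * br B g + t * br C g = 0.
  rewrite /br !mulr_sumr -!big_split /=; apply: big1 => i _.
  transitivity ((x * A (e i) + y * B (e i) + t * C (e i)) * g (d i)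
    - (x * A (d i) + y * B (d i) + t * C (d i)) * g (e i)); first by ring.
  by rewrite !rel !mul0r subrr.
have br_self f : br f f = 0.
  by rewrite /br; apply: big1 => i _; rewrite mulrC subrr.
have brC f g : br f g = - br g f.
  by rewrite /br -sumrN; apply: eq_bigr => i _; ring.
have y0 : y = 0.
  have := brx C; rewrite AC br_self !mulr0 add0r addr0 => /eqP.
  by rewrite mulf_eq0 (negPf BC) orbF => /eqP.
have t0 : t = 0.
  have := brx B; rewrite AB br_self !mulr0 !add0r brC mulrN => /eqP.
  by rewrite oppr_eq0 mulf_eq0 (negPf BC) orbF => /eqP.
split=> //; have := rel v; rewrite y0 t0 !mul0r !addr0 => /eqP.
by rewrite mulf_eq0 (negPf Av) orbF => /eqP.
Qed.

(** This is [bracket_lin_indep] for the maps sending [w] to ['D_w H z], ['D_w F z] and ['D_w G z],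
    with the position and momentum directions as [e] and [d]: [br] is then the Poisson bracket at
    [z]. *)
Lemma lin_indep_of_poisson (R : realType) n (H F G : phase R n -> R) (z v : phase R n) :
  differentiable H z -> differentiable F z -> differentiable G z ->
  poisson H F z = 0 -> poisson H G z = 0 -> poisson F G z != 0 ->
  'D_v H z != 0 -> lin_indep_differentials [tuple H; F; G] z.
Proof.
move=> dH dF dG HF HG FG Hv a rel.
have {}rel w : a ord0 * 'D_w H z + a (lift ord0 ord0) * 'D_w F z
    + a (lift ord0 (lift ord0 ord0)) * 'D_w G z = 0.
  rewrite (deriveE w dH) (deriveE w dF) (deriveE w dG).
  have sum3 (c : 'I_3 -> R) :
      \sum_i c i = c ord0 + c (lift ord0 ord0) + c (lift ord0 (lift ord0 ord0)).
    by rewrite !big_ord_recl big_ord0 addr0 addrA.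
  by apply: etrans (esym (sum3 _)) (rel w).
have [a0 a1 a2] := bracket_lin_indep HF HG FG Hv rel.
(* The coefficients are indexed by the iterated [lift ord0] that [big_ord_recl] produces, so an
   arbitrary index of ['I_3] is matched with these forms. *)
have lift_eq (P : pred 'I_3) : P ord0 -> P (lift ord0 ord0) ->
  P (lift ord0 (lift ord0 ord0)) -> forall i, P i.
  move=> p0 p1 p2 [[|[|[|//]]] i3].
  - by rewrite (_ : Ordinal _ = ord0) //; apply: val_inj.
  - by rewrite (_ : Ordinal _ = lift ord0 ord0) //; apply: val_inj.
  - by rewrite (_ : Ordinal _ = lift ord0 (lift ord0 ord0)) //; apply: val_inj.
by move=> i; apply/eqP; move: i; apply: lift_eq; apply/eqP.
Qed.

Lemma functionally_independent_TJK (R : realType) :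
  functionally_independent (@dom R) [tuple @T R; @J R; @K R].
Proof.
(* On [dom], where [u1], [u2] and [u1 - u2] are nonzero, the first two factors control the vanishing
   of [J], hence of {J,K}; the last two control that of dT/dp1. *)
pose G (z : phase R 2) : R := (z.2 0 0 - z.2 0 1)
  * (z.1 0 0 ^+ 2 * z.2 0 0 - z.1 0 1 ^+ 2 * z.2 0 1) * z.2 0 0
  * (2 * z.1 0 0 + z.1 0 1).
(* The point u = (1,0), p = (1,0) lies outside [dom], which is harmless: [dense_neq0] only asks that
   [G] be nonzero somewhere. *)
have G0 : G (delta_mx 0 0, delta_mx 0 0) != 0.
  rewrite /G /= !mxE /=; have -> : (1 - 0) * (1 ^+ 2 * 1 - 0 ^+ 2 * 0) * 1 * (2 * 1 + 0) = 2 :> R by ring.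
  by rewrite pnatr_eq0.
(* Along a line every coordinate is affine in [t], so [G] becomes a polynomial in [t]. *)
have Gp w v : exists p : {poly R}, forall t, G (t *: v + w) = p.[t].
  pose lin (a b : R) := a *: 'X + b%:P.
  pose u1 := lin (v.1 0 0) (w.1 0 0). pose u2 := lin (v.1 0 1) (w.1 0 1).
  pose p1 := lin (v.2 0 0) (w.2 0 0). pose p2 := lin (v.2 0 1) (w.2 0 1).
  exists ((p1 - p2) * (u1 ^+ 2 * p1 - u2 ^+ 2 * p2) * p1 * (2%:P * u1 + u2)) => t.
  by rewrite /G !hornerE /= !mxE; ring.
move=> z dz; have := dense_neq0 (@open_dom R) dz G0 Gp; apply: closure_subset.
move=> {z dz}z [dz]; rewrite /= /G !mulf_eq0 !negb_or -!andbA => /and4P[s0 l0 p0 k0].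
have [u12 /=] := dz; rewrite mulf_eq0 negb_or => /andP[u10 u20].
have d0 : z.1 0 0 - z.1 0 1 != 0 by rewrite subr_eq0.
split=> //; apply: (lin_indep_of_poisson (v := mom_dir R 0)).
- exact: smooth_differentiable (@smooth_T R) dz.
- exact: smooth_differentiable (@smooth_J R) dz.
- exact: smooth_differentiable (@smooth_K R) dz.
- exact: poisson_TJ.
- exact: poisson_TK.
- by rewrite poisson_JK // /J /= !(mulf_neq0, expf_neq0, invr_neq0) ?pnatr_eq0.
rewrite derive_T //= !mxE /= !mulr0 mulr1 !add0r addr0.
by rewrite !mulf_neq0 ?invr_neq0 ?pnatr_eq0.
Qed.

(** * Degree in the momenta *)

(** The coefficients are extended by zero off the diagonal [i + j = d], so each inner sum of the
    definition keeps a single term. *)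
Lemma momentum_degree_homogeneous (R : realType) (D : set (phase R 2)) d
    (f : phase R 2 -> R) (a : nat -> 'rV[R]_2 -> R) :
  (forall z, D z ->
    f z = \sum_(i < d.+1) a i z.1 * z.2 0 0 ^+ i * z.2 0 1 ^+ (d - i)) ->
  (exists z (i : nat), [/\ D z, (i <= d)%N & a i z.1 != 0]) ->
  momentum_degree D d f.
Proof.
move=> fE [z [i [Dz id a0]]].
exists (fun i j u => if (i + j == d)%N then a i u else 0).
split=> [y /fE ->|]; last by exists z, i; rewrite subnKC ?eqxx.
apply: eq_bigr => k _.
(* [r] is the index of the surviving term; [rev_ord k] is [d.+1 - k.+1], that is [d - k]. *)
have [r rE] : exists r : 'I_d.+1, (r : nat) = (d - k)%N.
  by exists (rev_ord k); rewrite /= subSS.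
have kd : (k + r)%N = d by rewrite rE subnKC // -ltnS.
rewrite (bigD1 r) ?kd //= eqxx -rE.
rewrite big1 ?addr0 //= => j /andP[_ jk]; case: eqP => [kj|]; last by rewrite !mul0r.
by case/eqP: jk; apply: val_inj; apply/eqP; rewrite -(eqn_add2l k) kj kd.
Qed.

Lemma momentum_degree_K (R : realType) : momentum_degree (@dom R) 4 (@K R).
Proof.
(* The list holds the coefficients of (p1 - p2)^3 (x p1 + y p2), by increasing power of p1. *)
pose a i (u : 'rV[R]_2) : R :=
  let u1 := u 0 0 in let u2 := u 0 1 in
  let x := 3 * u1 + u2 in let y := u1 + 3 * u2 in
  u1 ^+ 2 * u2 ^+ 2 / (u1 - u2) ^+ 3
    * [:: - y; 3 * y - x; 3 * x - 3 * y; y - 3 * x; x]`_i.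
apply: (momentum_degree_homogeneous (a := a)) => [z [u12 _]|].
  have d0 : z.1 0 0 - z.1 0 1 != 0 by rewrite subr_eq0.
  by rewrite !big_ord_recl big_ord0 /a /K /=; field.
(* At u = (1,2) the coefficient of p1^4 is nonzero because x = 3 u1 + u2 = 5. *)
exists (\row_j (j.+1)%:R, 0), 4; split=> //.
  by split; rewrite /= !mxE /= ?mulf_neq0 ?pnatr_eq0 // eqr_nat.
rewrite /a /= !mxE /= !mulf_neq0 ?invr_neq0 ?expf_neq0 ?pnatr_eq0 //.
by rewrite subr_eq0 eqr_nat.
Qed.

Lemma momentum_degree_J (R : realType) : momentum_degree (@dom R) 3 (@J R).
Proof.
(* The list holds the coefficients of (p1 - p2)^2 (u1^2 p1 - u2^2 p2), by increasing power of p1. *)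
pose a i (u : 'rV[R]_2) : R :=
  let u1 := u 0 0 in let u2 := u 0 1 in
  u1 * u2 / (u1 - u2) ^+ 3
    * [:: - u2 ^+ 2; u1 ^+ 2 + 2 * u2 ^+ 2; - (2 * u1 ^+ 2 + u2 ^+ 2); u1 ^+ 2]`_i.
apply: (momentum_degree_homogeneous (a := a)) => [z [u12 _]|].
  have d0 : z.1 0 0 - z.1 0 1 != 0 by rewrite subr_eq0.
  by rewrite !big_ord_recl big_ord0 /a /J /=; field.
exists (\row_j (j.+1)%:R, 0), 3; split=> //.
  by split; rewrite /= !mxE /= ?mulf_neq0 ?pnatr_eq0 // eqr_nat.
rewrite /a /= !mxE /= !mulf_neq0 ?invr_neq0 ?expf_neq0 ?pnatr_eq0 //.
by rewrite subr_eq0 eqr_nat.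
Qed.

Theorem mainTheorem7 (R : realType) :
  [/\ superintegrable (@dom R) (@T R),
      first_integral (@dom R) (@T R) (@K R)
        /\ first_integral (@dom R) (@T R) (@J R),
      functionally_independent (@dom R) [tuple @T R; @J R; @K R],
      momentum_degree (@dom R) 4 (@K R) /\ momentum_degree (@dom R) 3 (@J R)
    & [/\ forall z, dom z -> poisson (@T R) (@K R) z = 0,
          forall z, dom z -> poisson (@T R) (@J R) z = 0
        & exists2 z, dom z & poisson (@J R) (@K R) z != 0]].
Proof.
have fK : first_integral (@dom R) (@T R) (@K R).
  by split; [exact: smooth_K|exact: poisson_TK].
have fJ : first_integral (@dom R) (@T R) (@J R).
  by split; [exact: smooth_J|exact: poisson_TJ].
split=> //.
- split; first exact: smooth_T.
  by exists (@J R), (@K R); split=> //; exact: functionally_independent_TJK.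
- exact: functionally_independent_TJK.
- by split; [exact: momentum_degree_K|exact: momentum_degree_J].
split; [exact: poisson_TK|exact: poisson_TJ|].
(* At u = (1,2), p = (1,0) one finds J = -2, so {J,K} = 4 J^2 = 16. *)
have dz : dom ((\row_j (j.+1)%:R, delta_mx 0 0) : phase R 2).
  by split; rewrite /= !mxE /= ?mulf_neq0 ?pnatr_eq0 // eqr_nat.
exists (\row_j (j.+1)%:R, delta_mx 0 0); rewrite ?poisson_JK //.
by rewrite /J /= !mxE /= subr0 mulr0 subr0 !(mulf_neq0, expf_neq0, invr_neq0) 
  ?oner_neq0 ?pnatr_eq0 // subr_eq0 eqr_nat.
Qed.
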